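(* For any Banach space $X$ with $\dim X\ge 2$, $$C_{L}(X)\ge \frac{1}{2}\left(9-G_L(X)\right).$$
   Context: For a Banach space $X$ with $\dim X\ge 2$, define $$C_{L}(X)=\sup\{\|x+y\|\cdot\|2x-y\|: x,y\in X,\ \|x\|=\|y\|=\|x-y\|=1\},$$ $$G_L(X)=\sup\{\|x+y\|^{2}+\|2x-y\|^{2}: x,y\in X,\ \|x\|=\|y\|=\|x-y\|=1\}.$$ *)

(* Defs.v *)
From HB Require Import structures.
From mathcomp Require Import all_boot all_order all_algebra.
From mathcomp Require Import all_classical all_reals all_analysis.
Set Implicit Arguments.
Unset Strict Implicit.
Unset Printing Implicit Defensive.
Import Order.TTheory GRing.Theory Num.Theory.
Import numFieldNormedType.Exports.
Local Open Scope classical_set_scope.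
Local Open Scope ring_scope.

(* n <= dim V, where V may be infinite-dimensional. *)
Definition dim_ge (R : fieldType) (V : lmodType R) (n : nat) : Prop :=
  exists e : 'I_n -> V,
    forall c : 'I_n -> R, \sum_(i < n) c i *: e i = 0 -> forall i, c i = 0.

(* The suprema below are taken in R. The underlying sets are bounded above by
   the triangle inequality, and nonempty as soon as 2 <= dim X, so that the
   default value of sup plays no role in that case. *)

Definition CL (R : realType) (X : normedModType R) : R :=
  sup [set r : R | exists x y : X,
    [/\ `|x| = 1, `|y| = 1, `|x - y| = 1 &
        r = `|x + y| * `|2%:R *: x - y|]].

Definition GL (R : realType) (X : normedModType R) : R :=
  sup [set r : R | exists x y : X,
    [/\ `|x| = 1, `|y| = 1, `|x - y| = 1 &
        r = `|x + y| ^+ 2 + `|2%:R *: x - y| ^+ 2]].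

(* Main.v *)
Require Import Defs.
From HB Require Import structures.
From mathcomp Require Import all_boot all_order all_algebra.
From mathcomp Require Import all_classical all_reals all_analysis.
From mathcomp Require Import ring lra.
Set Implicit Arguments.
Unset Strict Implicit.
Unset Printing Implicit Defensive.
Import Order.TTheory GRing.Theory Num.Theory.
Import numFieldNormedType.Exports.
Local Open Scope classical_set_scope.
Local Open Scope ring_scope.

(** Write [a = `|x + y|] and [b = `|2 x - y|] for an admissible pair [(x, y)],
    that is, one with [`|x| = `|y| = `|x - y| = 1]. Since
    [(x + y) + (2 x - y) = 3 x], the triangle inequality gives [a + b >= 3], so
    [2 * CL X + GL X >= 2 a b + (a ^+ 2 + b ^+ 2) = (a + b) ^+ 2 >= 9].
    A single admissible pair thus suffices. It exists in dimension at least 2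
    because a unit vector [x] can be joined to [- x] by a path on the unit
    sphere, along which the distance to [x] varies continuously from 0 to 2. *)

(** The path is the normalization of [t x + (1 - t ^+ 2) f], where [x] is the
    normalization of [e]. It avoids 0 because [e] and [f] are independent, and
    it takes the values [- x] and [x] at [-1] and [1]. *)
Lemma equilateral_unit_pair (R : realType) (X : normedModType R) :
  dim_ge X 2 -> exists x y : X, [/\ `|x| = 1, `|y| = 1 & `|x - y| = 1].
Proof.
move=> [b b_free]; pose e := b ord0; pose f := b ord_max.
have indep (s t : R) : s *: e + t *: f = 0 -> s = 0 /\ t = 0.
  move=> st0.
  have /b_free c0 : \sum_(i < 2) (if i == ord0 then s else t) *: b i = 0.
    rewrite big_ord_recr big_ord1 /= -[RHS]st0.
    by congr (_ *: b _ + _); exact/val_inj.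
  by split; [have := c0 ord0 | have := c0 ord_max].
have e_neq0 : `|e| != 0.
  rewrite normr_eq0; apply/eqP => e0.
  have [/eqP] := indep 1 0 ltac:(by rewrite e0 scaler0 scale0r addr0).
  by rewrite oner_eq0.
pose x : X := `|e|^-1 *: e.
have x1 : `|x| = 1 by rewrite normrZ normfV normr_id mulVf.
pose v (t : R) : X := t *: x + (1 - t ^+ 2) *: f.
have v_neq0 t : `|v t| != 0.
  rewrite normr_eq0; apply/eqP; rewrite /v scalerA => /indep[/eqP].
  rewrite mulf_eq0 invr_eq0 (negPf e_neq0) orbF => /eqP->.
  by rewrite expr0n subr0 => /eqP; rewrite oner_eq0.
pose y t : X := `|v t|^-1 *: v t.
have y1 t : `|y t| = 1 by rewrite normrZ normfV normr_id mulVf.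
have v_cont : continuous v.
  move=> t; apply: cvgD; apply: cvgZr_tmp; first exact: cvg_id.
  by apply: cvgB; [exact: cvg_cst | exact: exprn_continuous].
have dist_cont : continuous (fun t => `|x - y t|).
  move=> t; apply: cvg_norm; apply: cvgB; first exact: cvg_cst.
  apply: cvgZ; last exact: v_cont.
  by apply: cvgV => //; apply: cvg_norm; exact: v_cont.
have y_right : y 1 = x.
  by rewrite /y /v expr1n subrr scale0r addr0 scale1r x1 invr1 scale1r.
have y_left : y (-1) = - x.
  rewrite /y /v sqrrN expr1n subrr scale0r addr0 scaleN1r.
  by rewrite normrN x1 invr1 scale1r.
have [|||t _ dist1] := @IVT R (fun t => `|x - y t|) (-1) 1 1.
- by lra.
- exact: continuous_subspaceT.
- rewrite y_right y_left subrr normr0 opprK -mulr2n normrMn x1.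
  by rewrite ge_min le_max; apply/andP; split; apply/orP; [right|left]; lra.
- by exists x, (y t).
Qed.

Lemma normD_unit_le (R : realType) (X : normedModType R) (x y : X) :
  `|x| = 1 -> `|y| = 1 -> `|x + y| <= 2.
Proof. by move=> x1 y1; have := ler_normD x y; rewrite x1 y1; lra. Qed.

Lemma normB2_unit_le (R : realType) (X : normedModType R) (x y : X) :
  `|x| = 1 -> `|y| = 1 -> `|2%:R *: x - y| <= 3.
Proof.
move=> x1 y1; have := ler_normB (2%:R *: x) y.
by rewrite normrZ normr_nat x1 y1; lra.
Qed.

Lemma le_CL (R : realType) (X : normedModType R) (x y : X) :
  `|x| = 1 -> `|y| = 1 -> `|x - y| = 1 ->
  `|x + y| * `|2%:R *: x - y| <= CL X.
Proof.
move=> x1 y1 xy1; apply: ub_le_sup; last by exists x, y.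
exists (2 * 3) => _ [u [w [u1 w1 _ ->]]].
by apply: ler_pM => //; [exact: normD_unit_le | exact: normB2_unit_le].
Qed.

Lemma le_GL (R : realType) (X : normedModType R) (x y : X) :
  `|x| = 1 -> `|y| = 1 -> `|x - y| = 1 ->
  `|x + y| ^+ 2 + `|2%:R *: x - y| ^+ 2 <= GL X.
Proof.
move=> x1 y1 xy1; apply: ub_le_sup; last by exists x, y.
exists (2 ^+ 2 + 3 ^+ 2) => _ [u [w [u1 w1 _ ->]]].
by apply: lerD; apply: lerXn2r; rewrite ?nnegrE //;
  [exact: normD_unit_le | exact: normB2_unit_le].
Qed.

Theorem proposition4p8 (R : realType) (X : completeNormedModType R)
    (dimX : dim_ge X 2) :
  CL X >= 2%:R^-1 * (9%:R - GL X).
Proof.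
have [x [y [x1 y1 xy1]]] := equilateral_unit_pair dimX.
have ab_ge3 : 3 <= `|x + y| + `|2%:R *: x - y|.
  apply: le_trans (ler_normD _ _).
  have -> : x + y + (2%:R *: x - y) = 3%:R *: x.
    rewrite [_ - y]addrC addrA addrK -{1}[x]scale1r -scalerDl.
    by congr (_ *: _); ring.
  by rewrite normrZ normr_nat x1 mulr1.
have := le_CL x1 y1 xy1; have := le_GL x1 y1 xy1.
move: ab_ge3; set a := `|x + y|; set b := `|_ - y| => ab_ge3 GL_ge CL_ge.
have : 0 <= (a + b - 3) * (a + b + 3) by apply: mulr_ge0; lra.
by nra.
Qed.
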